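(* The creation operator tuple $V=(V_1,\dots,V_d)$ on the full Fock space $\Gamma(\mathbb C^d)$ is maximal, i.e. $\Delta_{V^n}=(1+d+\cdots+d^{n-1})\,\Delta_V$ for every positive integer $n$.
   Context: Fix a positive integer $d$. The full Fock space over $\mathbb C^d$ is $\Gamma(\mathbb C^d)=\mathbb C\oplus\mathbb C^d\oplus(\mathbb C^d)^{\otimes2}\oplus\cdots\oplus(\mathbb C^d)^{\otimes k}\oplus\cdots$ (Hilbert space direct sum), with vacuum vector $\omega=(1,0,0,\dots)$. Let $e_1,\dots,e_d$ be an orthonormal basis of $\mathbb C^d$. The creation operators are $V_i\xi=e_i\otimes\xi$ for $\xi\in\Gamma(\mathbb C^d)$, $1\le i\le d$, where $e_i\otimes\omega$ is identified with $e_i$. For a contractive $d$-tuple $T=(T_1,\dots,T_d)$ of bounded operators on a Hilbert space (i.e. $\sum_i T_iT_i^*\le I$), put $P_T(X)=\sum_{i=1}^dT_iXT_i^*$, let $P_T^n$ be its $n$-fold iterate, and define the $n$-th defect dimension $\Delta_{T^n}=\dim\overline{\mathrm{Range}}\,(I-P_T^n(I))$, with $\Delta_T=\Delta_{T^1}$. The tuple $T$ is called maximal if $\Delta_{T^n}=(1+d+\cdots+d^{n-1})\Delta_T$ for every positive integer $n$. *)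

(* Defs.v *)
From HB Require Import structures.
From mathcomp Require Import all_boot all_order all_algebra.
From mathcomp Require Import sesquilinear spectral complex.
From mathcomp Require Import all_classical all_reals all_analysis.
From mathcomp Require Import ring lra.

Set Implicit Arguments.
Unset Strict Implicit.
Unset Printing Implicit Defensive.

Import Order.TTheory GRing.Theory Num.Theory.
Import numFieldNormedType.Exports.

Local Open Scope classical_set_scope.
Local Open Scope ring_scope.
Local Open Scope complex_scope.

(* Complex Hilbert spaces; [inner] is linear in its first argument. *)
HB.mixin Record CompleteNormedModule_isHilbert (R : realType) H
    & CompleteNormedModule R[i] H := {
  inner : H -> H -> R[i] ;
  inner_linearl : forall v, linear_for *%R (inner^~ v) ;
  inner_conj : forall u v, inner u v = (inner v u)^* ;
  inner_norm : forall u, inner u u = `|u| ^+ 2 }.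

#[short(type="hilbertType")]
HB.structure Definition Hilbert (R : realType) :=
  {H of CompleteNormedModule R[i] H & CompleteNormedModule_isHilbert R H}.

Section inner_dot.
Context (R : realType) (H : hilbertType R).
Local Notation ip := (@inner R H).

Let ip_bilinear : bilinear_for *%R (Num.conj \; *%R) ip.
Proof.
split; first exact: inner_linearl.
move=> u a v w /=; rewrite inner_conj inner_linearl rmorphD rmorphM /=.
by rewrite -!inner_conj.
Qed.

HB.instance Definition _ :=
  bilinear_isBilinear.Build R[i] H H R[i] *%R (Num.conj \; *%R) ip ip_bilinear.

Let ip_hermitian u v : ip u v = (-1) ^+ false * Num.conj (ip v u).
Proof. by rewrite expr0 mul1r inner_conj. Qed.

HB.instance Definition _ :=
  isHermitianSesquilinear.Build R[i] H false Num.conj ip ip_hermitian.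

Let ip_gt0 u : u != 0 -> 0 < ip u u.
Proof. by move=> u0; rewrite inner_norm exprn_gt0// normr_gt0. Qed.

HB.instance Definition _ := isDotProduct.Build R[i] H ip ip_gt0.

End inner_dot.

(* The [k]-th tensor power of C^d, in coordinates with respect to the product
   basis of the standard basis: [u w] is the coefficient of
   delta_(w_1) (x) ... (x) delta_(w_k). *)
Definition tensor (R : realType) (d k : nat) := {ffun k.-tuple 'I_d -> R[i]}.

Section tensor.
Context (R : realType) (d k : nat).
Implicit Types u v : tensor R d k.

Definition tensor_inner u v : R[i] := \sum_w u w * (v w)^*.

Definition tensor_sqnorm u : R := complex.Re (tensor_inner u u).

Lemma tensor_inner_linearl v : linear_for *%R (tensor_inner^~ v).
Proof.
move=> a u1 u2; rewrite /tensor_inner mulr_sumr -big_split /=.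
by apply: eq_bigr => w _; rewrite !ffunE mulrDl -mulrA.
Qed.

Lemma tensor_innerDl u1 u2 v :
  tensor_inner (u1 + u2) v = tensor_inner u1 v + tensor_inner u2 v.
Proof. by have := tensor_inner_linearl v 1 u1 u2; rewrite scale1r mul1r. Qed.

Lemma tensor_innerZl a u v : tensor_inner (a *: u) v = a * tensor_inner u v.
Proof.
rewrite /tensor_inner mulr_sumr; apply: eq_bigr => w _.
by rewrite ffunE -mulrA.
Qed.

Lemma tensor_inner_conj u v : tensor_inner u v = (tensor_inner v u)^*.
Proof.
rewrite /tensor_inner rmorph_sum; apply: eq_bigr => w _.
by rewrite rmorphM /= conjcK mulrC.
Qed.

Lemma tensor_sqnormE u :
  tensor_sqnorm u = \sum_w (complex.Re (u w) ^+ 2 + complex.Im (u w) ^+ 2).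
Proof.
rewrite /tensor_sqnorm /tensor_inner.
have ReD : {morph @complex.Re R : x y / x + y} by move=> [? ?] [? ?].
rewrite (big_morph _ ReD (erefl : complex.Re 0 = 0)).
by apply: eq_bigr => w _; case: (u w) => a b /=; ring.
Qed.

Lemma tensor_sqnorm_ge0 u : 0 <= tensor_sqnorm u.
Proof.
by rewrite tensor_sqnormE sumr_ge0// => w _; rewrite addr_ge0// sqr_ge0.
Qed.

Lemma tensor_innerE u : tensor_inner u u = (tensor_sqnorm u)%:C.
Proof.
have := tensor_inner_conj u u; rewrite /tensor_sqnorm.
by case: (tensor_inner u u) => a b /= [] bN; congr (_ +i* _); lra.
Qed.

Lemma tensor_sqnormD u v : tensor_sqnorm (u + v) =
  tensor_sqnorm u + tensor_sqnorm v + 2 * complex.Re (tensor_inner u v).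
Proof.
rewrite /tensor_sqnorm tensor_innerDl (tensor_inner_conj u (u + v)).
rewrite (tensor_inner_conj v (u + v)) !tensor_innerDl (tensor_inner_conj v u).
case: (tensor_inner u u) (tensor_inner v v) (tensor_inner u v) => [? ?] [? ?] [? ?] /=.
by ring.
Qed.

Lemma tensor_sqnormZ a u :
  tensor_sqnorm (a *: u) = (complex.Re a ^+ 2 + complex.Im a ^+ 2) * tensor_sqnorm u.
Proof.
rewrite !tensor_sqnormE mulr_sumr; apply: eq_bigr => w _; rewrite ffunE.
by case: a (u w) => [? ?] [? ?] /=; ring.
Qed.

Lemma tensor_sqnormN u : tensor_sqnorm (- u) = tensor_sqnorm u.
Proof. by rewrite -scaleN1r tensor_sqnormZ /= sqrrN expr1n oppr0 expr0n addr0 mul1r. Qed.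

Lemma tensor_sqnorm0 : tensor_sqnorm 0 = 0.
Proof. by rewrite -(scale0r 0) tensor_sqnormZ /= expr0n addr0 mul0r. Qed.

Lemma tensor_sqnorm_eq0 u : tensor_sqnorm u = 0 -> u = 0.
Proof.
rewrite tensor_sqnormE => /eqP; rewrite psumr_eq0; last first.
  by move=> w _; rewrite addr_ge0// sqr_ge0.
move=> /allP h; apply/ffunP => w; rewrite ffunE.
have /(_ (mem_index_enum w)) := h w; rewrite paddr_eq0 ?sqr_ge0// !sqrf_eq0.
by case: (u w) => a b /= /andP[/eqP -> /eqP ->].
Qed.

Lemma Re_tensor_inner_le u v :
  `|complex.Re (tensor_inner u v)| <= tensor_sqnorm u + tensor_sqnorm v.
Proof.
have h1 := tensor_sqnorm_ge0 (u + v); have h2 := tensor_sqnorm_ge0 (u - v).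
have h3 := tensor_sqnorm_ge0 u; have h4 := tensor_sqnorm_ge0 v.
have E : complex.Re (tensor_inner u (- v)) = - complex.Re (tensor_inner u v).
  rewrite tensor_inner_conj -scaleN1r tensor_innerZl (tensor_inner_conj u v).
  by case: (tensor_inner v u) => ? ? /=; ring.
move: h1 h2; rewrite !tensor_sqnormD tensor_sqnormN E => h1 h2.
by rewrite ler_norml; apply/andP; split; lra.
Qed.

Lemma Im_tensor_inner u v :
  complex.Im (tensor_inner u v) = complex.Re (tensor_inner (- 'i *: u) v).
Proof.
rewrite tensor_innerZl.
by case: (tensor_inner u v) => a b /=; ring.
Qed.

End tensor.


Section nonneg_series.
Context (R : realType) (a : R^nat).
Hypothesis a_ge0 : forall n, 0 <= a n.

Lemma nonneg_series_cvg M : (forall n, \sum_(k < n) a k <= M) -> cvgn (series a).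
Proof.
move=> aM; apply: nondecreasing_is_cvgn; first exact: nondecreasing_series.
by exists M => _ [n _ <-]; rewrite /series /= big_mkord.
Qed.

Lemma nonneg_series_le n : cvgn (series a) -> \sum_(k < n) a k <= limn (series a).
Proof.
move=> ac; have := nondecreasing_cvgn_le (nondecreasing_series (fun _ _ _ => a_ge0 _)) ac n.
by rewrite /series /= big_mkord.
Qed.

Lemma nonneg_series_lim_le M : (forall n, \sum_(k < n) a k <= M) ->
  limn (series a) <= M.
Proof.
move=> aM; apply: limr_le; first exact: nonneg_series_cvg aM.
by apply: nearW => n; rewrite /series /= big_mkord.
Qed.

End nonneg_series.

(* The full Fock space of C^d: the Hilbert space direct sum of the tensor
   powers, i.e. the sequences of tensors with summable squared norms. *)
Record fock (R : realType) (d : nat) := Fock {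
  fock_comp :> forall k, tensor R d k ;
  fock_summable : cvgn (series (fun k => tensor_sqnorm (fock_comp k))) }.

Section fock.
Context (R : realType) (d : nat).
Local Notation F := (fock R d).
Implicit Types x y z : F.

HB.instance Definition _ := gen_eqMixin F.
HB.instance Definition _ := gen_choiceMixin F.

Let sqnorm_ge0 x k : 0 <= tensor_sqnorm (x k).
Proof. exact: tensor_sqnorm_ge0. Qed.

Lemma fockP x y : (forall k, x k = y k) -> x = y.
Proof.
case: x y => [x xs] [y ys] /= xy.
have {}xy : x = y by exact: functional_extensionality_dep.
by move: ys; rewrite -xy => ys; congr Fock; exact: Prop_irrelevance.
Qed.

Lemma fock_summable0 :
  cvgn (series (fun k => tensor_sqnorm (0 : tensor R d k))).
Proof.
apply: (@nonneg_series_cvg _ _ _ 0) => [k|n]; first exact: tensor_sqnorm_ge0.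
by rewrite big1// => k _; rewrite tensor_sqnorm0.
Qed.

Lemma fock_summableN x : cvgn (series (fun k => tensor_sqnorm (- x k))).
Proof.
under eq_fun do rewrite tensor_sqnormN.
exact: fock_summable.
Qed.

Lemma tensor_sqnormD_le k (u v : tensor R d k) :
  tensor_sqnorm (u + v) <= 2 * (tensor_sqnorm u + tensor_sqnorm v).
Proof.
have := tensor_sqnorm_ge0 (u - v).
have := tensor_sqnormD (u - v) (v + v).
rewrite (_ : u - v + (v + v) = u + v); last by rewrite addrA subrK.
have := tensor_sqnormD (u - v) v; rewrite subrK => h1.
rewrite (tensor_sqnormD v v) [tensor_inner (u - v) (v + v)]tensor_inner_conj.
rewrite tensor_innerDl (tensor_inner_conj v (u - v)).
have -> : tensor_inner v v = (tensor_sqnorm v)%:C by exact: tensor_innerE.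
by move: h1; case: (tensor_inner (u - v) v) => a b /=; lra.
Qed.

Lemma fock_summableD x y : cvgn (series (fun k => tensor_sqnorm (x k + y k))).
Proof.
apply: series_le_cvg (fun k => tensor_sqnormD_le (x k) (y k)) _ => [k|k|].
- exact: tensor_sqnorm_ge0.
- by rewrite mulr_ge0// addr_ge0.
- apply: is_cvg_seriesZ; apply: is_cvg_seriesD; exact: fock_summable.
Qed.

Lemma fock_summableZ a x : cvgn (series (fun k => tensor_sqnorm (a *: x k))).
Proof.
under eq_fun do rewrite tensor_sqnormZ.
by apply: is_cvg_seriesZ; exact: fock_summable.
Qed.

Definition fock0 : F := @Fock R d (fun=> 0) (@fock_summable0).
Definition fock_opp x : F := @Fock R d (fun k => - x k) (@fock_summableN x).
Definition fock_add x y : F := @Fock R d (fun k => x k + y k) (@fock_summableD x y).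
Definition fock_scale a x : F := @Fock R d (fun k => a *: x k) (@fock_summableZ a x).

Let addA : associative fock_add.
Proof. by move=> x y z; apply: fockP => k; exact: addrA. Qed.
Let addC : commutative fock_add.
Proof. by move=> x y; apply: fockP => k; exact: addrC. Qed.
Let add0 : left_id fock0 fock_add.
Proof. by move=> x; apply: fockP => k; exact: add0r. Qed.
Let addN : left_inverse fock0 fock_opp fock_add.
Proof. by move=> x; apply: fockP => k; exact: addNr. Qed.

HB.instance Definition _ := GRing.isZmodule.Build F addA addC add0 addN.

Let scaleA a b x : fock_scale a (fock_scale b x) = fock_scale (a * b) x.
Proof. by apply: fockP => k; exact: scalerA. Qed.
Let scale1 : left_id 1 fock_scale.
Proof. by move=> x; apply: fockP => k; exact: scale1r. Qed.
Let scaleDr : right_distributive fock_scale +%R.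
Proof. by move=> a x y; apply: fockP => k; exact: scalerDr. Qed.
Let scaleDl x : {morph fock_scale^~ x : a b / a + b}.
Proof. by move=> a b; apply: fockP => k; exact: scalerDl. Qed.

HB.instance Definition _ :=
  GRing.Zmodule_isLmodule.Build R[i] F scaleA scale1 scaleDr scaleDl.

Definition fock_inner x y : R[i] :=
  limn (series (fun k => complex.Re (tensor_inner (x k) (y k)))) +i*
  limn (series (fun k => complex.Im (tensor_inner (x k) (y k)))).

Definition fock_sqnorm x : R := limn (series (fun k => tensor_sqnorm (x k))).

Lemma fock_sqnorm_ge0 x : 0 <= fock_sqnorm x.
Proof. by have := nonneg_series_le (sqnorm_ge0 x) 0 (@fock_summable R d x); rewrite big_ord0. Qed.

Lemma cvg_Re_inner x y :
  cvgn (series (fun k => complex.Re (tensor_inner (x k) (y k)))).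
Proof.
apply: normed_cvg.
apply: series_le_cvg (fun k => Re_tensor_inner_le (x k) (y k)) _ => [k|k|].
- exact: normr_ge0.
- by rewrite addr_ge0.
- by apply: is_cvg_seriesD; exact: fock_summable.
Qed.

Lemma cvg_Im_inner x y :
  cvgn (series (fun k => complex.Im (tensor_inner (x k) (y k)))).
Proof.
under eq_fun do rewrite Im_tensor_inner.
exact: (@cvg_Re_inner (- 'i *: x) y).
Qed.

Lemma fock_inner_linearl y : linear_for *%R (fock_inner^~ y).
Proof.
move=> a x1 x2; rewrite /fock_inner.
have S f g (c e : R) : cvgn (series f) -> cvgn (series g) ->
    limn (series (c *: f + e *: g)) = c * limn (series f) + e * limn (series g).
  move=> fc gc; rewrite lim_seriesD; [|exact: is_cvg_seriesZ..].
  by rewrite !lim_seriesZ.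
pose r1 k := complex.Re (tensor_inner (x1 k) (y k)).
pose r2 k := complex.Re (tensor_inner (x2 k) (y k)).
pose i1 k := complex.Im (tensor_inner (x1 k) (y k)).
pose i2 k := complex.Im (tensor_inner (x2 k) (y k)).
have R1 : cvgn (series r1) by exact: cvg_Re_inner.
have R2 : cvgn (series r2) by exact: cvg_Re_inner.
have I1 : cvgn (series i1) by exact: cvg_Im_inner.
have I2 : cvgn (series i2) by exact: cvg_Im_inner.
have T k : tensor_inner ((a *: x1 + x2) k) (y k) =
    a * tensor_inner (x1 k) (y k) + tensor_inner (x2 k) (y k).
  exact: tensor_inner_linearl.
have S1 : cvgn (series (complex.Re a *: r1 + (- complex.Im a) *: i1)).
  by apply: is_cvg_seriesD; exact: is_cvg_seriesZ.
have S2 : cvgn (series (complex.Re a *: i1 + complex.Im a *: r1)).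
  by apply: is_cvg_seriesD; exact: is_cvg_seriesZ.
transitivity
  (limn (series (1 *: (complex.Re a *: r1 + (- complex.Im a) *: i1) + 1 *: r2))
  +i* limn (series (1 *: (complex.Re a *: i1 + complex.Im a *: r1) + 1 *: i2))).
  congr (limn (series _) +i* limn (series _)); apply/funext => k.
    rewrite T !scale1r !fctE /r1 /r2 /i1; case: a {S1 S2 T} => p q.
    case: (tensor_inner (x1 k) (y k)) (tensor_inner (x2 k) (y k)) => [? ?] [? ?].
    by rewrite /= /GRing.scale /=; ring.
  rewrite T !scale1r !fctE /r1 /i1 /i2; case: a {S1 S2 T} => p q.
  case: (tensor_inner (x1 k) (y k)) (tensor_inner (x2 k) (y k)) => [? ?] [? ?].
  by rewrite /= /GRing.scale /=; ring.
rewrite (S _ _ _ _ S1 R2) (S _ _ _ _ S2 I2) (S _ _ _ _ R1 I1) (S _ _ _ _ I1 R1).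
case: a {S1 S2 T} => p q /=.
by congr (_ +i* _); ring.
Qed.

Lemma fock_inner_conj x y : fock_inner x y = (fock_inner y x)^*.
Proof.
rewrite /fock_inner /=; congr (_ +i* _).
  congr (limn (series _)); apply/funext => k; rewrite tensor_inner_conj.
  by case: tensor_inner.
rewrite -lim_seriesN; last exact: cvg_Im_inner.
congr (limn (series _)); apply/funext => k; rewrite tensor_inner_conj fctE.
by case: tensor_inner.
Qed.

Lemma fock_innerE x : fock_inner x x = (fock_sqnorm x)%:C.
Proof.
congr (_ +i* _); under eq_fun do rewrite tensor_innerE.
by apply/cvg_lim => //; rewrite /series /=; under eq_fun do rewrite big1_eq; exact: cvg_cst.
Qed.

Definition fock_norm x : R := Num.sqrt (fock_sqnorm x).

Lemma fock_innerDl x1 x2 y :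
  fock_inner (x1 + x2) y = fock_inner x1 y + fock_inner x2 y.
Proof. by have := fock_inner_linearl y 1 x1 x2; rewrite scale1r mul1r. Qed.

Lemma fock_inner0l y : fock_inner 0 y = 0.
Proof. by apply: (addrI (fock_inner 0 y)); rewrite -fock_innerDl !addr0. Qed.

Lemma fock_innerZl a x y : fock_inner (a *: x) y = a * fock_inner x y.
Proof. by rewrite -[a *: x]addr0 fock_inner_linearl fock_inner0l addr0. Qed.

Lemma fock_sqnormDZ x y (t : R) : fock_sqnorm (x + t%:C *: y) =
  fock_sqnorm x + 2 * t * complex.Re (fock_inner x y) + t ^+ 2 * fock_sqnorm y.
Proof.
apply: (@complexI R); rewrite -fock_innerE fock_innerDl fock_innerZl.
rewrite (fock_inner_conj x (x + _)) (fock_inner_conj y (x + _)).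
rewrite !fock_innerDl !fock_innerZl (fock_inner_conj y x) !fock_innerE.
case: (fock_inner x y) => a b.
apply/eqP; rewrite eq_complex /=; apply/andP; split; apply/eqP; ring.
Qed.

Lemma fock_sqnormZ a x :
  fock_sqnorm (a *: x) = (complex.Re a ^+ 2 + complex.Im a ^+ 2) * fock_sqnorm x.
Proof.
rewrite /fock_sqnorm; set c := (X in X * _).
have := lim_seriesZ c (@fock_summable R d x); rewrite /GRing.scale /= => <-.
by congr (limn (series _)); apply/funext => k; exact: tensor_sqnormZ.
Qed.

Lemma sqr_fock_norm x : fock_norm x ^+ 2 = fock_sqnorm x.
Proof. by rewrite sqr_sqrtr// fock_sqnorm_ge0. Qed.

Lemma Re_fock_inner_le x y :
  complex.Re (fock_inner x y) <= fock_norm x * fock_norm y.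
Proof.
set r := complex.Re _; have x0 := fock_sqnorm_ge0 x; have y0 := fock_sqnorm_ge0 y.
have nx0 : 0 <= fock_norm x by exact: sqrtr_ge0.
have ny0 : 0 <= fock_norm y by exact: sqrtr_ge0.
have h t : 0 <= fock_sqnorm x + 2 * t * r + t ^+ 2 * fock_sqnorm y.
  by rewrite -fock_sqnormDZ fock_sqnorm_ge0.
suff : r ^+ 2 <= (fock_norm x * fock_norm y) ^+ 2.
  have [r0 _|r0] := leP r 0; first by rewrite (le_trans r0)// mulr_ge0.
  by rewrite ler_sqr// nnegrE ?mulr_ge0// ltW.
rewrite exprMn !sqr_fock_norm.
have [Ny0|Ny0] := eqVneq (fock_sqnorm y) 0.
  have [->|rn0] := eqVneq r 0; first by rewrite expr0n mulr_ge0.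
  have := h (- (fock_sqnorm x + 1) / (2 * r)); rewrite Ny0.
  have -> : 2 * (- (fock_sqnorm x + 1) / (2 * r)) * r = - (fock_sqnorm x + 1).
    by field.
  lra.
have := h (- r / fock_sqnorm y).
have -> : fock_sqnorm x + 2 * (- r / fock_sqnorm y) * r +
   (- r / fock_sqnorm y) ^+ 2 * fock_sqnorm y =
   (fock_sqnorm x * fock_sqnorm y - r ^+ 2) / fock_sqnorm y by field.
by rewrite pmulr_lge0 ?subr_ge0// invr_gt0 lt_def Ny0.
Qed.

Lemma fock_normD x y : fock_norm (x + y) <= fock_norm x + fock_norm y.
Proof.
rewrite -ler_sqr ?nnegrE ?addr_ge0 ?sqrtr_ge0// sqr_fock_norm.
have := fock_sqnormDZ x y 1; rewrite scale1r => ->.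
have := Re_fock_inner_le x y.
rewrite sqrrD !sqr_fock_norm; lra.
Qed.

Lemma fock_norm_eq0 x : fock_norm x = 0 -> x = 0.
Proof.
move=> /(congr1 (fun r => r ^+ 2)); rewrite sqr_fock_norm expr0n /= => x0.
apply: fockP => k; apply: tensor_sqnorm_eq0; apply/eqP; rewrite eq_le sqnorm_ge0 andbT.
have := nonneg_series_le (sqnorm_ge0 x) k.+1 (@fock_summable R d x).
rewrite -/(fock_sqnorm x) x0 big_ord_recr /=; apply: le_trans.
by rewrite lerDr sumr_ge0.
Qed.

Let norm x : R[i] := (fock_norm x)%:C.

Let norm_triangle x y : norm (x + y) <= norm x + norm y.
Proof. by rewrite /norm -rmorphD /= lecR fock_normD. Qed.

Let norm_scale a x : norm (a *: x) = `|a| * norm x.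
Proof.
rewrite /norm normc_def -rmorphM /=; congr (_%:C).
by rewrite /fock_norm fock_sqnormZ sqrtrM// addr_ge0 ?sqr_ge0.
Qed.

Let norm_eq0 x : norm x = 0 -> x = 0.
Proof. by move=> /(@complexI R) /fock_norm_eq0. Qed.

HB.instance Definition _ :=
  Lmodule_isNormed.Build R[i] F norm_triangle norm_scale norm_eq0.

Lemma fock_normE x : `|x| = (fock_norm x)%:C. Proof. by []. Qed.

Lemma tensor_sqnorm_le x k : tensor_sqnorm (x k) <= fock_sqnorm x.
Proof.
have := nonneg_series_le (sqnorm_ge0 x) k.+1 (@fock_summable R d x).
apply: le_trans; rewrite big_ord_recr /= lerDr sumr_ge0 //.
Qed.

Lemma fock_coord_le x k w : (complex.Re (x k w)) ^+ 2 + (complex.Im (x k w)) ^+ 2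
  <= fock_sqnorm x.
Proof.
apply: le_trans _ (tensor_sqnorm_le x k); rewrite tensor_sqnormE (bigD1 w)//=.
by rewrite lerDl sumr_ge0// => v _; rewrite addr_ge0 ?sqr_ge0.
Qed.

Lemma fock_cauchy_coord (G : set_system F) (f : F -> R) :
  (forall x y, `|f x - f y| <= fock_norm (x - y)) ->
  ProperFilter G -> cauchy G -> cvg (f @ G).
Proof.
move=> fle FG /cauchy_ballP Gc; apply: cauchy_cvg; apply/cauchy_ballP => e e0.
have e0C : 0 < e%:C by rewrite ltcR.
have [/= [A B] /= [GA GB] AB] := Gc _ e0C.
exists (f @` A, f @` B).
  by split; [apply: filterS GA | apply: filterS GB] => z Az; exists z.
case=> _ _ /= [[a Aa <-] [b Bb <-]].
have /= := AB (a, b) (conj Aa Bb); rewrite -ball_normE /ball_ /= fock_normE ltcR.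
by move=> h; rewrite -ball_normE /ball_ /=; exact: le_lt_trans (fle _ _) h.
Qed.

Lemma cvg_sumr T (G : set_system T) I (r : seq I) (f : I -> T -> R) (l : I -> R) :
  Filter G -> (forall i, f i @ G --> l i) ->
  (fun t => \sum_(i <- r) f i t) @ G --> \sum_(i <- r) l i.
Proof.
move=> FG fl; elim: r => [|i r IH].
  by rewrite big_nil; under eq_fun do rewrite big_nil; exact: cvg_cst.
by rewrite big_cons; under eq_fun do rewrite big_cons; exact: cvgD.
Qed.

Let fock_complete (G : set_system F) : ProperFilter G -> cauchy G -> cvg G.
Proof.
move=> FG Gc.
have Rcvg k w : cvg ((fun x : F => complex.Re (x k w)) @ G).
  apply: fock_cauchy_coord => // x y; rewrite /fock_norm.
  apply: le_trans _ (ler_wsqrtr (fock_coord_le (x - y) w)).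
  rewrite -sqrtr_sqr; apply: ler_wsqrtr; rewrite !ffunE.
  case: (x k w) (y k w) => [? ?] [? ?] /=; rewrite lerDl; exact: sqr_ge0.
have Icvg k w : cvg ((fun x : F => complex.Im (x k w)) @ G).
  apply: fock_cauchy_coord => // x y; rewrite /fock_norm.
  apply: le_trans _ (ler_wsqrtr (fock_coord_le (x - y) w)).
  rewrite -sqrtr_sqr; apply: ler_wsqrtr; rewrite !ffunE.
  case: (x k w) (y k w) => [? ?] [? ?] /=; rewrite lerDr; exact: sqr_ge0.
pose L k : tensor R d k := [ffun w =>
  lim ((fun x : F => complex.Re (x k w)) @ G) +i*
  lim ((fun x : F => complex.Im (x k w)) @ G)].
have fatou x (e : R) n : 0 < e -> (\forall y \near G, `|x - y| < e%:C) ->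
    \sum_(k < n) tensor_sqnorm (x k - L k) <= e ^+ 2.
  move=> e0 Gx.
  have cvL : (fun y : F => \sum_(k < n) tensor_sqnorm (x k - y k)) @ G -->
      \sum_(k < n) tensor_sqnorm (x k - L k).
    rewrite (_ : (fun y : F => _) = fun y : F => \sum_(k < n) \sum_w
        ((complex.Re (x k w) - complex.Re (y k w)) ^+ 2 +
         (complex.Im (x k w) - complex.Im (y k w)) ^+ 2)); last first.
      apply/funext => y; apply: eq_bigr => k _; rewrite tensor_sqnormE.
      apply: eq_bigr => w _; rewrite !ffunE.
      by case: (x k w) (y k w) => [? ?] [? ?].
    rewrite (_ : \sum_(k < n) _ = \sum_(k < n) \sum_w
        ((complex.Re (x k w) - complex.Re (L k w)) ^+ 2 +
         (complex.Im (x k w) - complex.Im (L k w)) ^+ 2)); last first.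
      apply: eq_bigr => k _; rewrite tensor_sqnormE.
      apply: eq_bigr => w _; rewrite !ffunE /=.
      by case: (x k w) => [? ?].
    apply: cvg_sumr => k; apply: cvg_sumr => w; rewrite !ffunE /=.
    by apply: cvgD; rewrite expr2; apply: cvgM; apply: cvgB;
      (exact: cvg_cst || exact: Rcvg || exact: Icvg).
  apply: cvgr_to_le cvL _.
  near=> y.
  have : `|x - y| < e%:C by near: y.
  rewrite fock_normE ltcR => /ltW xy.
  apply: le_trans (nonneg_series_le (sqnorm_ge0 (x - y)) n (@fock_summable R d _)) _.
  by rewrite -/(fock_sqnorm _) -sqr_fock_norm ler_sqr// nnegrE ?sqrtr_ge0// ltW.
have Gnear (e : R) : 0 < e -> \forall x \near G, \forall y \near G, `|x - y| < e%:C.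
  move=> e0; have /cauchy_ballP/(_ e%:C) := Gc; rewrite ltcR => /(_ e0).
  by rewrite -ball_normE => /nearP_dep.
have Lsum : cvgn (series (fun k => tensor_sqnorm (L k))).
  have [x Gx] := @filter_ex _ _ _ _ (Gnear 1 ltr01).
  have xL : cvgn (series (fun k => tensor_sqnorm (x k - L k))).
    apply: (@nonneg_series_cvg _ _ _ (1 ^+ 2)) => [k|n].
      exact: tensor_sqnorm_ge0.
    exact: fatou.
  have := @fock_summableD x (- (Fock xL)).
  by under eq_fun do rewrite /= opprB addrC subrK.
apply/cvg_ex; exists (Fock Lsum); apply/cvgrPdist_le => e e0.
have [eI eR] : complex.Im e = 0 /\ 0 < complex.Re e.
  by move: e0; rewrite ltcE /= => /andP[/eqP -> ->].
have -> : e = (complex.Re e)%:C by move: eI; case: (e) => ? ? /= ->.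
near=> x.
rewrite distrC fock_normE lecR -ler_sqr ?nnegrE ?sqrtr_ge0 ?(ltW eR)//.
rewrite sqr_fock_norm; apply: nonneg_series_lim_le => [k|n].
  exact: tensor_sqnorm_ge0.
by apply: (fatou x) => //; near: x; exact: Gnear.
Unshelve. all: by end_near. Qed.

HB.instance Definition _ := Uniform_isComplete.Build F fock_complete.

Let inner_norm x : fock_inner x x = `|x| ^+ 2.
Proof. by rewrite fock_innerE fock_normE -rmorphXn /= sqr_fock_norm. Qed.

HB.instance Definition _ := CompleteNormedModule_isHilbert.Build R F
  fock_inner_linearl fock_inner_conj inner_norm.

End fock.

Section creation.
Context (R : realType) (d : nat).

(* The elementary tensor e (x) u. *)
Definition tensor_cons k (e : 'rV[R[i]]_d) (u : tensor R d k) : tensor R d k.+1 :=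
  [ffun w => e ord0 (thead w) * u (behead_tuple w)].

Lemma tensor_sqnorm_cons k e (u : tensor R d k) :
  tensor_sqnorm (tensor_cons e u) =
  (\sum_j (complex.Re (e ord0 j) ^+ 2 + complex.Im (e ord0 j) ^+ 2)) * tensor_sqnorm u.
Proof.
rewrite !tensor_sqnormE mulr_suml.
under [RHS]eq_bigr do rewrite mulr_sumr.
rewrite pair_big /= (reindex (fun p : 'I_d * k.-tuple 'I_d => [tuple of p.1 :: p.2])) /=.
  apply: eq_bigr => -[j w] _; rewrite !ffunE /= theadE.
  rewrite (_ : @behead_tuple k.+1 _ _ = w); last exact: val_inj.
  by case: (e _ _) (u w) => [? ?] [? ?] /=; ring.
exists (fun w : k.+1.-tuple 'I_d => (thead w, behead_tuple w)).
  by move=> [j w] _ /=; congr (_, _); exact: val_inj.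
by move=> w _; rewrite /= [RHS]tuple_eta; exact: val_inj.
Qed.

(* Components of e (x) x: degree k goes to degree k+1, the scalar in degree 0
   (the vacuum component) being identified with a tensor of length 0. *)
Definition creation_comp (e : 'rV[R[i]]_d) (x : fock R d) k : tensor R d k :=
  match k with 0 => 0 | k'.+1 => tensor_cons e (x k') end.

Lemma creation_summable e x :
  cvgn (series (fun k => tensor_sqnorm (creation_comp e x k))).
Proof.
set c := \sum_j (complex.Re (e ord0 j) ^+ 2 + complex.Im (e ord0 j) ^+ 2).
have c0 : 0 <= c by apply: sumr_ge0 => j _; rewrite addr_ge0 ?sqr_ge0.
apply: (@nonneg_series_cvg _ _ _ (c * fock_sqnorm x)) => [k|[|n]].
- exact: tensor_sqnorm_ge0.
- by rewrite big_ord0 mulr_ge0// fock_sqnorm_ge0.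
rewrite big_ord_recl /= tensor_sqnorm0 add0r.
under eq_bigr do rewrite /= tensor_sqnorm_cons.
rewrite -mulr_sumr ler_wpM2l//.
by apply: nonneg_series_le (@fock_summable R d x) => k; exact: tensor_sqnorm_ge0.
Qed.

Definition creation (e : 'rV[R[i]]_d) (x : fock R d) : fock R d :=
  Fock (@creation_summable e x).

Let creation_linear e : linear (creation e).
Proof.
move=> a x y; apply: fockP => -[|k].
  by rewrite /= scaler0 addr0.
by apply/ffunP => w; rewrite !ffunE /= mulrDr mulrCA.
Qed.

HB.instance Definition _ e :=
  GRing.isLinear.Build R[i] (fock R d) (fock R d) *:%R (creation e)
    (creation_linear e).

End creation.

Section operators.
Context (R : realType) (H : hilbertType R).

(* The Hilbert space adjoint; it exists and is unique for bounded T. *)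
Definition adjoint (T : H -> H) : H -> H :=
  xget (fun=> 0) [set S : H -> H | forall x y, inner (T x) y = inner x (S y)].

(* [b] is an orthonormal basis of S, S being exactly its linear span. *)
Definition orthonormal_basis (S : set H) (b : seq H) :=
  orthonormal (@inner R H) b /\
  S = [set \sum_(i < size b) c i *: b`_i | c in [set: 'I_(size b) -> R[i]]].

(* Hilbert space dimension of a closed subspace, with all infinite cardinals
   identified with +oo. *)
Definition hdim (S : set H) : \bar R :=
  xget +oo%E [set ((size b)%:R%:E : \bar R) | b in orthonormal_basis S].

Context (d : nat).
Implicit Type T : 'I_d -> {linear H -> H}.

Definition contractive_tuple T :=
  (forall i, continuous (T i)) /\
  (forall x, inner (\sum_i T i (adjoint (T i) x)) x <= inner x x).

Definition conj_map T (X : H -> H) : H -> H :=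
  fun x => \sum_i T i (X (adjoint (T i) x)).

Definition defect_dim T n : \bar R :=
  hdim (closure (range (fun x => x - iter n (conj_map T) id x))).

Definition maximal_tuple T :=
  contractive_tuple T /\
  forall n, (0 < n)%N ->
    defect_dim T n = ((\sum_(k < n) d ^ k)%N%:R%:E * defect_dim T 1)%E.

End operators.

(* Main.v *)
Require Import Defs.
From mathcomp Require Import all_boot all_order all_algebra.
From mathcomp Require Import sesquilinear spectral complex.
From mathcomp Require Import all_classical all_reals all_analysis.
From mathcomp Require Import lra.
Import Order.TTheory GRing.Theory Num.Theory.
Import numFieldNormedType.Exports.
Local Open Scope ring_scope.

Set Implicit Arguments.
Unset Strict Implicit.
Unset Printing Implicit Defensive.

(** Write V_i for the creation operator of e_i.  Its adjoint is the
    annihilation operator, which contracts the first tensor factor with e_i.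
    Since e is an orthonormal basis of C^d, the sum of the e_i e_i^* is the
    identity; hence sum_i V_i V_i^* restores every first factor it has removed,
    and only kills the vacuum component, which has no first factor.  As V_i
    raises degrees by one, the same computation shows that P_V sends the
    projection onto the degrees >= n to the projection onto the degrees >= n+1
    ([conj_map_tail]), so that P_V^n(I) is the projection [fock_tail n].

    Therefore I - P_V^n(I) is the projection onto the vectors of degree < n.
    This subspace is closed ([closure_degree_lt]) and the elementary tensors
    indexed by the words of length < n on d letters form an orthonormal basis
    of it ([hdim_degree_lt]), so the n-th defect dimension is
    1 + d + ... + d^(n-1); the first one is 1, and V is maximal. *)

(** * Adjoints and dimension in a Hilbert space *)

Section hilbert.
Local Open Scope classical_set_scope.
Context (R : realType) (H : hilbertType R).
Implicit Types (S : set H) (b : seq H).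

Lemma inner_separates (y z : H) : (forall x : H, inner x y = inner x z) -> y = z.
Proof.
move=> yz; apply/eqP; rewrite -subr_eq0 -normr_eq0 -sqrf_eq0 -inner_norm.
by rewrite linearBr /= yz subrr.
Qed.

(** The adjoint is picked by a choice operator; as the inner product separates
    points, a formal adjoint is unique, so any exhibited one is the chosen one. *)
Lemma adjointE (T S : H -> H) :
  (forall x y, inner (T x) y = inner x (S y)) -> adjoint T = S.
Proof.
move=> TS; apply: xget_unique => // S' TS'; apply/funext => y.
by apply: inner_separates => x; rewrite -TS' TS.
Qed.

Lemma inner_suml (I : finType) (f : I -> H) (c : I -> R[i]) (y : H) :
  inner (\sum_i c i *: f i) y = \sum_i c i * inner (f i) y.
Proof. by rewrite linear_sumlz; apply: eq_bigr => i _; rewrite linearZl_LR. Qed.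

Lemma inner_orthonormal_span b (c c' : 'I_(size b) -> R[i]) :
  orthonormal (@inner R H) b ->
  inner (\sum_i c i *: b`_i) (\sum_i c' i *: b`_i) = \sum_i c i * (c' i)^*.
Proof.
move=> /orthonormalP[ub ob]; rewrite inner_suml; apply: eq_bigr => i _.
congr (_ * _); rewrite inner_conj inner_suml (bigD1 i) //= ob ?mem_nth// eqxx mulr1.
rewrite big1 ?addr0// => j ji; rewrite ob ?mem_nth// nth_uniq//.
by rewrite (inj_eq val_inj) (negPf ji) mulr0.
Qed.

(** Orthonormality makes the matrix A of coordinates of b on b' satisfy
    A A^* = 1, and a matrix with a right inverse has at most as many rows as
    columns. *)
Lemma orthonormal_basis_size S b b' :
  orthonormal_basis S b -> orthonormal_basis S b' -> (size b <= size b')%N.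
Proof.
move=> [ob Sb] [ob' Sb'].
have bS (i : 'I_(size b)) : exists c : 'I_(size b') -> R[i],
    \sum_j c j *: b'`_j = b`_i.
  suff : S b`_i by rewrite Sb' => -[c _ <-]; exists c.
  rewrite Sb; exists (fun j => (j == i)%:R) => //=.
  rewrite (bigD1 i)//= eqxx scale1r big1 ?addr0// => j /negPf ->.
  by rewrite scale0r.
have [A AE] := choice bS.
apply: (@mulmx1_min R[i] _ _ (\matrix_(i, k) A i k) (\matrix_(k, j) (A j k)^*)).
apply/matrixP => i j; rewrite !mxE.
under eq_bigr do rewrite !mxE.
rewrite -(inner_orthonormal_span _ _ ob') !AE.
by have /orthonormalP[ub ->] := ob; rewrite ?mem_nth// nth_uniq.
Qed.

(** Two orthonormal bases bound each other's size, so the dimension, which is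
    chosen among the sizes of orthonormal bases, is forced. *)
Lemma hdimE S b : orthonormal_basis S b -> hdim S = (size b)%:R%:E.
Proof.
move=> Sb; apply: xget_unique; first by exists b.
move=> _ [b' Sb' <-]; congr (_%:R%:E).
by apply/eqP; rewrite eqn_leq !(@orthonormal_basis_size S).
Qed.

Lemma hdim_span (I : finType) (f : I -> H) :
  (forall i j, inner (f i) (f j) = (i == j)%:R) ->
  hdim [set \sum_i c i *: f i | c in [set: I -> R[i]]] = #|I|%:R%:E.
Proof.
move=> fo.
have f_inj : injective f.
  move=> i j /(congr1 (inner (f i))); rewrite !fo eqxx.
  by case: eqP => // _ /eqP; rewrite oner_eq0.
pose b := [seq f i | i <- enum I].
have sb : size b = #|I| by rewrite size_map -cardE.
rewrite -sb; apply: hdimE; split.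
  apply/orthonormalP; split; first by rewrite map_inj_uniq// enum_uniq.
  by move=> _ _ /mapP[i _ ->] /mapP[j _ ->]; rewrite (inj_eq f_inj); exact: fo.
(* Combinations of the list b and of the family f correspond through the
   numbering of I. *)
have bE (g : 'I_(size b) -> R[i]) (c : I -> R[i]) :
    (forall i, g (cast_ord (esym sb) (enum_rank i)) = c i) ->
    \sum_i g i *: b`_i = \sum_i c i *: f i.
  move=> gc; rewrite (reindex (fun i => cast_ord (esym sb) (enum_rank i))) /=.
    apply: eq_bigr => i _; rewrite gc; congr (_ *: _).
    by rewrite (nth_map i) -?cardE ?ltn_ord// nth_enum_rank.
  exists (fun k => enum_val (cast_ord sb k)) => k _.
    by rewrite cast_ordKV enum_rankK.
  by rewrite enum_valK cast_ordK.
apply/seteqP; split=> [_ [c _ <-]|_ [g _ <-]].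
  exists (fun k => c (enum_val (cast_ord sb k))) => //.
  by apply: bE => i; rewrite cast_ordKV enum_rankK.
by exists (fun i => g (cast_ord (esym sb) (enum_rank i))) => //; rewrite -(bE g).
Qed.

End hilbert.

(** * Series of real numbers *)

Section series.
Local Open Scope classical_set_scope.
Context (R : realType).

Lemma cvg_series_finite_support (f : R^nat) n :
  (forall k, (n <= k)%N -> f k = 0) -> series f @ \oo --> \sum_(k < n) f k.
Proof.
move=> f0; apply: cvg_near_cst; exists n => // m /= nm.
rewrite /series /= (big_cat_nat (leq0n n) nm) /= big_mkord [X in _ + X]big1_seq ?addr0//.
by move=> k; rewrite mem_index_iota => /andP[_ /andP[/f0]].
Qed.

Lemma limn_series_shift (f g : R^nat) :
  f 0%N = 0 -> (forall k, f k.+1 = g k) -> cvgn (series g) ->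
  limn (series f) = limn (series g).
Proof.
move=> f0 fg gc; apply/cvg_lim => //; rewrite -cvg_shiftS.
rewrite (_ : (fun n => _) = series g)//; apply/funext => n.
rewrite /series /= big_nat_recl// f0 add0r.
by apply: eq_bigr => k _; rewrite fg.
Qed.

End series.

(** * Contraction of the first tensor factor *)

Section tensor_theory.
Local Open Scope classical_set_scope.
Context (R : realType) (d : nat).
Local Open Scope complex_scope.

Lemma sum_tuple_cons k (F : k.+1.-tuple 'I_d -> R[i]) :
  \sum_w F w = \sum_j \sum_(w : k.-tuple 'I_d) F [tuple of j :: w].
Proof.
rewrite pair_big /= (reindex (fun p : 'I_d * k.-tuple 'I_d => [tuple of p.1 :: p.2]))//=.
exists (fun w : k.+1.-tuple 'I_d => (thead w, behead_tuple w)).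
  by move=> [j w] _ /=; congr (_, _); exact: val_inj.
by move=> w _; rewrite /= [RHS]tuple_eta; exact: val_inj.
Qed.

Lemma tensor_consE k (e : 'rV[R[i]]_d) (u : tensor R d k) j (w : k.-tuple 'I_d) :
  tensor_cons e u [tuple of j :: w] = e ord0 j * u w.
Proof. by rewrite ffunE theadE; congr (_ * u _); exact: val_inj. Qed.

(** The adjoint of u |-> e (x) u: conj(e) is paired with the first factor. *)
Definition contract k (e : 'rV[R[i]]_d) (v : tensor R d k.+1) : tensor R d k :=
  [ffun w : k.-tuple 'I_d => \sum_j (e ord0 j)^* * v [tuple of j :: w]].

Lemma tensor_inner_cons k e (u : tensor R d k) v :
  tensor_inner (tensor_cons e u) v = tensor_inner u (contract e v).
Proof.
rewrite /tensor_inner sum_tuple_cons exchange_big /=; apply: eq_bigr => w _.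
rewrite ffunE rmorph_sum mulr_sumr; apply: eq_bigr => j _.
by rewrite tensor_consE rmorphM /= conjCK mulrCA mulrA.
Qed.

(** The positivity of |v - s (e (x) u)|^2, for u the contraction of v by e and
    s real, gives the bound: the cross term is -2 s |u|^2, because u is the
    adjoint image of v.  The best s would be 1 / |e|^2; taking 1 / (1 + |e|^2)
    avoids the case e = 0. *)
Lemma tensor_sqnorm_contract k e (v : tensor R d k.+1) :
  tensor_sqnorm (contract e v) <=
  (1 + \sum_j (complex.Re (e ord0 j) ^+ 2 + complex.Im (e ord0 j) ^+ 2)) *
  tensor_sqnorm v.
Proof.
set c := \sum_j _; set u := contract e v.
have c0 : 0 <= c by apply: sumr_ge0 => j _; rewrite addr_ge0 ?sqr_ge0.
have := tensor_sqnorm_ge0 (- ((1 + c)^-1)%:C *: tensor_cons e u + v).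
rewrite tensor_sqnormD tensor_innerZl tensor_inner_cons -/u tensor_innerE.
rewrite tensor_sqnormZ tensor_sqnorm_cons -/c /=.
set U := tensor_sqnorm u; set W := tensor_sqnorm v => h.
have U0 : 0 <= U by exact: tensor_sqnorm_ge0.
have W0 : 0 <= W by exact: tensor_sqnorm_ge0.
have c1 : 1 + c != 0 by rewrite gt_eqF// ltr_pwDl.
set s := (1 + c)^-1 in h *.
have sc : s * (1 + c) = 1 by rewrite mulVf.
have s0 : 0 <= s by rewrite invr_ge0 addr_ge0.
have : s * U <= W by nra.
by rewrite -(ler_pM2l (_ : 0 < 1 + c)) ?ltr_pwDl// mulrA (mulrC _ s) sc mul1r.
Qed.

End tensor_theory.

(** * Annihilation operators, degrees and elementary tensors in the Fock space *)

Section fock_theory.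
Local Open Scope classical_set_scope.
Context (R : realType) (d : nat).
Local Open Scope complex_scope.
Implicit Types (x y : fock R d) (e : 'rV[R[i]]_d).

Lemma fock_sumE (I : Type) (r : seq I) (P : pred I) (f : I -> fock R d) k :
  (\sum_(i <- r | P i) f i : fock R d) k = \sum_(i <- r | P i) f i k.
Proof. exact: (big_morph (fun x : fock R d => x k)). Qed.

Lemma sum_tensor_sqnorm_le x n : \sum_(k < n) tensor_sqnorm (x k) <= fock_sqnorm x.
Proof.
by apply: nonneg_series_le (@fock_summable R d x) => k; exact: tensor_sqnorm_ge0.
Qed.

Lemma annihilation_summable e x :
  cvgn (series (fun k => tensor_sqnorm (contract e (x k.+1)))).
Proof.
set c := 1 + \sum_j (complex.Re (e ord0 j) ^+ 2 + complex.Im (e ord0 j) ^+ 2).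
have c0 : 0 <= c by rewrite addr_ge0// sumr_ge0// => j _; rewrite addr_ge0 ?sqr_ge0.
apply: (@nonneg_series_cvg _ _ _ (c * fock_sqnorm x)) => [k|n].
  exact: tensor_sqnorm_ge0.
apply: (@le_trans _ _ (\sum_(k < n) c * tensor_sqnorm (x k.+1))).
  by apply: ler_sum => k _; exact: tensor_sqnorm_contract.
rewrite -mulr_sumr ler_wpM2l//.
apply: le_trans _ (sum_tensor_sqnorm_le x n.+1).
by rewrite big_ord_recl lerDr tensor_sqnorm_ge0.
Qed.

Definition annihilation e x : fock R d := Fock (@annihilation_summable e x).

(** In degree k+1 this is the adjunction between tensoring with e and
    contracting with e; in degree 0 the left-hand side has no contribution, so
    the two series of inner products differ by a shift. *)
Lemma inner_creation e x y :
  inner (creation e x) y = inner x (annihilation e y).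
Proof.
have inner0 : tensor_inner (creation e x 0%N) (y 0%N) = 0.
  by rewrite /tensor_inner big1// => w _; rewrite ffunE mul0r.
have innerS k : tensor_inner (creation e x k.+1) (y k.+1) =
    tensor_inner (x k) (annihilation e y k) by rewrite tensor_inner_cons.
congr (_ +i* _); apply: limn_series_shift => [|k|]; rewrite ?inner0 ?innerS//.
- exact: cvg_Re_inner.
- exact: cvg_Im_inner.
Qed.

Lemma adjoint_creation e : adjoint (creation e) = annihilation e.
Proof. by apply: adjointE => x y; exact: inner_creation. Qed.

(** The Cuntz-type relation V_e^* V_e' = (e' | e) I of the full Fock space. *)
Lemma annihilation_creation e e' x :
  annihilation e (creation e' x) = dotmx e' e *: x.
Proof.
apply: fockP => k; apply/ffunP => w; rewrite ffunE [RHS]ffunE dotmxE mxE scaler_suml.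
apply: eq_bigr => j _; rewrite tensor_consE !mxE.
by rewrite mulrCA mulrA.
Qed.

Lemma tail_summable n x :
  cvgn (series (fun k => tensor_sqnorm (if (k < n)%N then 0 else x k))).
Proof.
apply: series_le_cvg (@fock_summable R d x) => k; first exact: tensor_sqnorm_ge0.
  exact: tensor_sqnorm_ge0.
by case: ifP => _ //; rewrite tensor_sqnorm0 tensor_sqnorm_ge0.
Qed.

(** The orthogonal projection onto the components of degree >= n. *)
Definition fock_tail n x : fock R d := Fock (@tail_summable n x).

(** The form taken by (P x | x) = |P x|^2 for an orthogonal projection P. *)
Lemma inner_tail n x : inner (fock_tail n x) x = (fock_sqnorm (fock_tail n x))%:C.
Proof.
rewrite -fock_innerE.
by congr (limn (series _) +i* limn (series _)); apply/funext => k /=;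
  case: ifP => // _; rewrite /tensor_inner !big1// => w _; rewrite ffunE mul0r.
Qed.

Lemma fock_sqnorm_tail_le n x : fock_sqnorm (fock_tail n x) <= fock_sqnorm x.
Proof.
apply: nonneg_series_lim_le => [k|m]; first exact: tensor_sqnorm_ge0.
apply: le_trans _ (sum_tensor_sqnorm_le x m).
apply: ler_sum => k _ /=; case: ifP => // _.
by rewrite tensor_sqnorm0 tensor_sqnorm_ge0.
Qed.

Definition degree_lt n : set (fock R d) :=
  [set x | forall k, (n <= k)%N -> x k = 0].

Lemma range_sub_tail n : range (fun x => x - fock_tail n x) = degree_lt n.
Proof.
apply/seteqP; split=> [_ [x _ <-] k nk|x xn].
  by rewrite /= ltnNge nk subrr.
exists x => //; apply: fockP => k; rewrite /=.
by have [kn|/xn ->] := ltnP k n; rewrite subr0.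
Qed.

(** Each homogeneous component is 1-Lipschitz, so a component that vanishes on
    a set vanishes on its closure. *)
Lemma closure_degree_lt n : closure (degree_lt n) = degree_lt n.
Proof.
apply/seteqP; split; last exact: subset_closure.
move=> x cx k nk; apply: tensor_sqnorm_eq0; apply/eqP; rewrite eq_le tensor_sqnorm_ge0 andbT.
rewrite leNgt; apply/negP => xk0.
(* A point y of degree < n at distance less than |x_k| from x would violate
   |x_k| = |(x - y)_k| <= |x - y|. *)
have e0 : 0 < (Num.sqrt (tensor_sqnorm (x k)))%:C by rewrite ltcR sqrtr_gt0.
have [y [yn]] := cx _ (nbhsx_ballx x _ e0).
rewrite -ball_normE /= fock_normE ltcR ltr_sqrt// ltNge => /negP; apply.
by have := tensor_sqnorm_le (x - y) k; rewrite /= yn// subr0.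
Qed.

Lemma delta_finite_support (s : seq 'I_d) k : ((size s).+1 <= k)%N ->
  [ffun w : k.-tuple 'I_d => (tval w == s)%:R] = 0 :> tensor R d k.
Proof.
move=> sk; apply/ffunP => w; rewrite !ffunE; case: eqP => // ws.
by move: sk; rewrite -ws size_tuple ltnn.
Qed.

Lemma delta_summable (s : seq 'I_d) : cvgn (series (fun k =>
  tensor_sqnorm ([ffun w : k.-tuple 'I_d => (tval w == s)%:R] : tensor R d k))).
Proof.
apply/cvg_ex; eexists; apply: (@cvg_series_finite_support _ _ (size s).+1) => k sk.
by rewrite delta_finite_support// tensor_sqnorm0.
Qed.

(** The elementary tensor of basis vectors spelled by the word s.  Comparing
    underlying words lets one formula cover all degrees: a tuple of length k
    can equal s only if k = size s. *)
Definition fock_delta (s : seq 'I_d) : fock R d := Fock (@delta_summable s).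

Lemma tensor_inner_delta s t k : tensor_inner (fock_delta s k) (fock_delta t k) =
  ((k == size s) && (s == t))%:R.
Proof.
rewrite /tensor_inner; have [->|ks] := eqVneq k (size s).
  rewrite (bigD1 (in_tuple s))//= !ffunE eqxx mul1r big1 ?addr0 ?rmorph_nat//.
  move=> w ws; rewrite !ffunE; case: eqP => [wE|_]; rewrite ?mul0r//.
  by case/eqP: ws; exact: val_inj.
rewrite big1// => w _; rewrite !ffunE; case: eqP => [wE|_]; rewrite ?mul0r//.
by rewrite -wE size_tuple eqxx in ks.
Qed.

Lemma inner_delta s t : inner (fock_delta s) (fock_delta t) = (s == t)%:R.
Proof.
pose f k : R := ((k == size s) && (s == t))%:R.
have fE k : tensor_inner (fock_delta s k) (fock_delta t k) = (f k)%:C.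
  by rewrite tensor_inner_delta rmorph_nat.
rewrite -(rmorph_nat (real_complex R)); congr (_ +i* _); apply/cvg_lim => //.
  under eq_fun do rewrite fE /=.
  have -> : (s == t)%:R = \sum_(k < (size s).+1) f k.
    rewrite big_ord_recr /= {2}/f eqxx big1 ?add0r// => k _.
    by rewrite /f ltn_eqF.
  by apply: cvg_series_finite_support => k sk; rewrite /f gtn_eqF.
under eq_fun do rewrite fE /=.
have := @cvg_series_finite_support R (fun=> 0) 0 (fun _ _ => erefl).
by rewrite big_ord0.
Qed.

End fock_theory.

(** * The dimension of the space of vectors of low degree *)

Section delta_basis.
Context (R : realType) (d n : nat).
Local Open Scope classical_set_scope.

Definition words_lt := {k : 'I_n & k.-tuple 'I_d}.

Definition word_of (p : words_lt) : seq 'I_d := tagged p.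

(** A word determines its own length, hence the index of the tensor power it
    lives in. *)
Lemma word_of_inj : injective word_of.
Proof.
move=> [k w] [l v] wv.
have kl : k = l.
  by apply: val_inj; rewrite /= -[RHS](size_tuple v) -[LHS](size_tuple w) [tval w]wv.
by case: l / kl v wv => v wv; congr existT; exact: val_inj.
Qed.

Lemma card_words_lt : #|{: words_lt}| = (\sum_(k < n) d ^ k)%N.
Proof.
rewrite card_tagged sumnE big_map big_enum /=.
by apply: eq_bigr => k _; rewrite card_tuple card_ord.
Qed.

(** The coefficient of the word w in x is the coordinate of x at w; a vector
    of degree < n involves only words of length < n. *)
Lemma degree_lt_span : degree_lt n =
  [set \sum_p c p *: fock_delta R (word_of p) | c in [set: words_lt -> R[i]]].
Proof.
apply/seteqP; split=> [x xn|_ [c _ <-] k nk].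
  exists (fun p : words_lt => x (tag p : nat) (tagged p)) => //; apply: fockP => k.
  rewrite fock_sumE; apply/ffunP => w; rewrite sum_ffunE.
  have [kn|nk] := ltnP k n; last first.
    rewrite xn// ffunE big1// => p _; rewrite !ffunE.
    case: eqP => [wp|_]; rewrite ?scaler0//.
    by move: nk; rewrite -(size_tuple w) wp size_tuple leqNgt ltn_ord.
  pose p0 : words_lt := Tagged (fun k : 'I_n => k.-tuple 'I_d) (w : (Ordinal kn).-tuple 'I_d).
  rewrite (bigD1 p0)//= !ffunE eqxx /GRing.scale /= mulr1 big1 ?addr0// => p pp0.
  rewrite !ffunE; case: eqP => [wp|_]; rewrite ?scaler0//.
  by case/eqP: pp0; exact: word_of_inj.
rewrite fock_sumE big1// => p _; rewrite /= delta_finite_support ?scaler0//.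
by rewrite (leq_trans _ nk)// size_tuple.
Qed.

Lemma hdim_degree_lt : hdim (@degree_lt R d n) = (\sum_(k < n) d ^ k)%N%:R%:E.
Proof.
rewrite degree_lt_span hdim_span ?card_words_lt// => p q.
by rewrite inner_delta (inj_eq word_of_inj).
Qed.

End delta_basis.

(** * The creation tuple of an orthonormal basis *)

Section creation_tuple.
Context (R : realType) (d : nat) (e : d.-tuple 'rV[R[i]]_d).
Context (e_orthonormal : orthonormal (@dotmx R[i] d) e).
Local Open Scope classical_set_scope.
Local Notation V := (fun i : 'I_d => creation (tnth e i)).

Lemma dotmx_orthonormal i j : dotmx (tnth e i) (tnth e j) = (i == j)%:R.
Proof.
have /orthonormalP[ue oe] := e_orthonormal.
by rewrite oe ?mem_tnth// (inj_eq (tuple_uniqP _ ue)).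
Qed.

(** The rows e_i form a square matrix M with M M^* = 1, and a one-sided inverse
    of a square matrix is two-sided, so M^* M = 1; these are the entries of the
    latter identity. *)
Lemma orthonormal_resolution j l :
  \sum_i tnth e i ord0 j * (tnth e i ord0 l)^* = (j == l)%:R.
Proof.
pose M : 'M[R[i]]_d := \matrix_i tnth e i.
have /unitarymxP MM : M \is unitarymx.
  by apply/row_unitarymxP => i i'; rewrite !rowK dotmx_orthonormal.
have /matrixP/(_ l j) := mulmx1C MM; rewrite !mxE eq_sym => <-.
by apply: eq_bigr => i _; rewrite !mxE mulrC.
Qed.

(** V_i is an isometry because V_i^* V_i = 1. *)
Lemma norm_creation i x : `|creation (tnth e i) x| = `|x|.
Proof.
apply/eqP; rewrite -(@eqrXn2 _ 2)// -!inner_norm inner_creation.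
by rewrite annihilation_creation dotmx_orthonormal eqxx scale1r.
Qed.

Lemma continuous_creation i : continuous (creation (tnth e i)).
Proof.
apply: bounded_linear_continuous; apply/linear_boundedP.
apply: filterS (nbhs_pinfty_ge (real1 R[i])) => r r1 x.
by rewrite norm_creation ler_peMl.
Qed.

(** V_i raises degrees by one and V_i^* lowers them by one, so both sides
    vanish in degrees <= n.  In higher degrees the coefficient of the left-hand
    side at j :: w is the sum over l of x (l :: w) weighted by
    sum_i e_i(j) conj(e_i(l)), which selects l = j by
    [orthonormal_resolution]. *)
Lemma conj_map_tail n : conj_map V (@fock_tail R d n) = @fock_tail R d n.+1.
Proof.
apply/funext => x; apply: fockP => k; rewrite /conj_map fock_sumE.
case: k => [|k]; first by rewrite big1.
apply/ffunP => w; case/tupleP: w => j w; rewrite sum_ffunE.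
under eq_bigr do rewrite adjoint_creation tensor_consE.
rewrite /= ltnS; case: ifP => _.
  by rewrite [RHS]ffunE big1// => i _; rewrite ffunE mulr0.
under eq_bigr do rewrite ffunE mulr_sumr.
rewrite exchange_big (bigD1 j)//= [X in _ + X]big1 ?addr0 => [|l lj].
  under eq_bigr do rewrite mulrA.
  by rewrite -mulr_suml orthonormal_resolution eqxx mul1r.
under eq_bigr do rewrite mulrA.
by rewrite -mulr_suml orthonormal_resolution eq_sym (negPf lj) mul0r.
Qed.

Lemma iter_conj_map n : iter n (conj_map V) id = @fock_tail R d n.
Proof.
elim: n => [|n IH]; last by rewrite iterS IH conj_map_tail.
by apply/funext => x; apply: fockP.
Qed.

(** Here sum_i V_i V_i^* is the projection [fock_tail 1] off the vacuum, and a
    projection is at most the identity. *)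
Lemma contractive_creation : contractive_tuple V.
Proof.
split=> [i|x]; first exact: continuous_creation.
rewrite -[X in inner X x]/(iter 1 (conj_map V) id x) iter_conj_map.
rewrite inner_tail [leRHS]fock_innerE lecR; exact: fock_sqnorm_tail_le.
Qed.

Lemma defect_dim_creation n : defect_dim V n = (\sum_(k < n) d ^ k)%N%:R%:E.
Proof.
by rewrite /defect_dim iter_conj_map range_sub_tail closure_degree_lt hdim_degree_lt.
Qed.

End creation_tuple.

Theorem lemma3p2 (R : realType) (d : nat) (d_gt0 : (0 < d)%N)
    (e : d.-tuple 'rV[R[i]]_d) (e_orthonormal : orthonormal (@dotmx R[i] d) e) :
  maximal_tuple (fun i : 'I_d => creation (tnth e i)).
Proof.
split=> [|n _]; first exact: contractive_creation.
by rewrite !defect_dim_creation// big_ord1 expn0 mule1.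
Qed.
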